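(* Let $\mathcal H$ be a complex separable infinite-dimensional Hilbert space. (a) Let $T\in L(\mathcal H)$ and $f_0\in\mathcal H$ be such that $(T^nf_0)_{n\in\mathbb N}$ is an overcomplete frame for $\mathcal H$. Then for each $f\in\mathcal H$ we have $$T^nf\to0\qquad\text{and}\qquad (T^* )^nf\to0\quad\text{as }n\to\infty.$$ (b) Let $T\in GL(\mathcal H)$ and $f_0\in\mathcal H$ be such that $(T^nf_0)_{n\in\mathbb Z}$ is a frame for $\mathcal H$ with frame bounds $A$ and $B$. Then for all $f\in\mathcal H$ and all $n\in\mathbb Z$ we have $$\|T^nf\|\ge\sqrt{\frac AB}\,\|f\|\qquad\text{and}\qquad\|(T^* )^nf\|\ge\sqrt{\frac AB}\,\|f\|.$$
   Context: $\mathbb N=\{0,1,2,\dots\}$. $L(\mathcal H)$ is the set of bounded linear operators on $\mathcal H$ and $GL(\mathcal H)$ the set of bijective ones. A countable system $(f_n)_{n\in I}$ is a frame for $\mathcal H$ with frame bounds $A$ (lower) and $B$ (upper), $A,B>0$, if $A\|f\|^2\le\sum_{n\in I}|\langle f,f_n\rangle|^2\le B\|f\|^2$ for all $f\in\mathcal H$. A frame is called overcomplete if it is not a Riesz basis. Convergence is in the norm of $\mathcal H$. *)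

(* Defs.v *)
From HB Require Import structures.
From mathcomp Require Import all_boot all_order all_algebra sesquilinear.
From mathcomp Require Import complex.
From mathcomp Require Import all_classical all_reals all_analysis.

Set Implicit Arguments.
Unset Strict Implicit.
Unset Printing Implicit Defensive.

Import Order.TTheory GRing.Theory Num.Theory.
Import numFieldNormedType.Exports.

Local Open Scope classical_set_scope.
Local Open Scope ring_scope.
Local Open Scope complex_scope.

(* The norm, hence the topology and the completeness, come from the complete
   normed module; they are tied to the inner product by hnorm_hdot. The inner
   product is linear in its first argument. *)
HB.mixin Record isHilbert (R : realType) H of CompleteNormedModule R[i] H := {
  hdot : {dot H for (@Num.conj R[i])};
  hnorm_hdot : forall x : H, `|x| ^+ 2 = hdot x x
}.

#[short(type="hilbertType")]
HB.structure Definition Hilbert (R : realType) :=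
  {H of isHilbert R H & CompleteNormedModule R[i] H}.

Section Defs.
Context {R : realType} {H : hilbertType R}.

Definition separable : Prop :=
  exists2 D : set H, countable D & dense D.

Definition lspan (I : eqType) (F : I -> H) : set H :=
  [set x | exists (s : seq I) (c : I -> R[i]), x = \sum_(i <- s) c i *: F i].

Definition infinite_dimensional : Prop :=
  forall (n : nat) (F : 'I_n -> H), lspan F <> [set: H].

Definition bounded_operator (T : H -> H) : Prop :=
  exists M : R, forall x : H, `|T x| <= M%:C * `|x|.

(* For bounded linear T exactly one map S satisfies the defining identity, by
   the Riesz representation theorem; otherwise the value may be a default. *)
Definition adjoint (T : H -> H) : H -> H :=
  xget (fun=> 0) [set S : H -> H | forall x y : H, hdot (T x) y = hdot x (S y)].

(* Powers with integer exponents; the pseudo-inverse 'pinv_ is the actual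
   inverse when T is bijective. *)
Definition zpow (T : H -> H) (n : int) : H -> H :=
  match n with
  | Posz k => iter k T
  | Negz k => iter k.+1 ('pinv_(fun=> 0) [set: H] T)
  end.

(* Squared norms and moduli are nonnegative reals living in R[i]; Re brings
   them to R. The series takes values in [0, +oo]. *)
Definition frame_with_bounds (I : countType) (F : I -> H) (A B : R) : Prop :=
  [/\ 0 < A, 0 < B &
    forall f : H,
      ((A * complex.Re (`|f| ^+ 2))%:E
         <= \esum_(i in [set: I]) (complex.Re (`|hdot f (F i)| ^+ 2))%:E
         <= (B * complex.Re (`|f| ^+ 2))%:E)%E].

Definition is_frame (I : countType) (F : I -> H) : Prop :=
  exists A B : R, frame_with_bounds F A B.

(* A complete system satisfying the two-sided Riesz inequality on finite
   sums. *)
Definition riesz_basis (I : countType) (F : I -> H) : Prop :=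
  closure (lspan F) = [set: H] /\
  exists a b : R, [/\ 0 < a, 0 < b &
    forall (s : seq I) (c : I -> R[i]), uniq s ->
      a%:C * \sum_(i <- s) `|c i| ^+ 2 <= `|\sum_(i <- s) c i *: F i| ^+ 2
        <= b%:C * \sum_(i <- s) `|c i| ^+ 2].

Definition overcomplete_frame (I : countType) (F : I -> H) : Prop :=
  is_frame F /\ ~ riesz_basis F.

End Defs.

Arguments separable {R} H.
Arguments infinite_dimensional {R} H.

(* Main.v *)
(* Write f_n = T^n f0, let S be the frame operator and D its inverse.

   The energy sum_k |<f, f_k>|^2 is comparable to |f|^2, and <T*^n f, f_k> =
   <f, f_(n+k)>. In (a) the energy of T*^n f is therefore a tail of the series
   for f and tends to 0; in (b) it equals that of f, which bounds T*^n from both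
   sides, and T^n is then bounded through the adjoint of T^(-n).

   For T^n -> 0 in (a), let p_n = <D f_n, f_n>, so that |f_n|^2 <= B p_n. Since
   the energy of D f_j is p_j, we have p_j^2 <= p_j, and p_j = 1 forces
   <D f_j, f_n> = 0 for n <> j. If every p_j is 1, the frame is a Riesz basis.
   Otherwise take the least j with p_j < 1. The tail S_j, the sum over n >= j of
   the rank one operators f_n (x) f_n, satisfies T S_j T* = S_j - f_j (x) f_j,
   and a Schur complement argument gives
   |<D f_j, f_(n+1)>|^2 <= (1 - p_j) (p_n - p_(n+1)) for n >= j. Summing over n,
   the left-hand sides add up to p_j - p_j^2, so p_n -> 0 and f_n -> 0. As the
   powers of T are uniformly bounded and the f_k span a dense subspace,
   T^n f -> 0 for every f. *)

Require Import Defs.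
From HB Require Import structures.
From mathcomp Require Import all_boot all_order all_algebra sesquilinear.
From mathcomp Require Import complex.
From mathcomp Require Import all_classical all_reals all_analysis.
From mathcomp Require Import lra ring zify.

Set Implicit Arguments.
Unset Strict Implicit.
Unset Printing Implicit Defensive.

Import Order.TTheory GRing.Theory Num.Theory.
Import numFieldNormedType.Exports.

Local Open Scope classical_set_scope.
Local Open Scope ring_scope.
Local Open Scope complex_scope.

(** * Real parts and squared moduli of complex numbers *)

Section RealParts.
Context {R : realType}.
Implicit Types z w : R[i].

Definition sqmod z : R := complex.Re (`|z| ^+ 2).

Lemma sqmodE z : sqmod z = complex.Re z ^+ 2 + complex.Im z ^+ 2.
Proof. by rewrite /sqmod -add_Re2_Im2. Qed.

Lemma sqmod_ge0 z : 0 <= sqmod z.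
Proof. by rewrite sqmodE addr_ge0 ?sqr_ge0. Qed.

Lemma sqmodC z : (sqmod z)%:C = z * Num.conj z.
Proof. by rewrite sqmodE add_Re2_Im2 normCK. Qed.

Lemma sqmod_conj z : sqmod (Num.conj z) = sqmod z.
Proof. by rewrite /sqmod norm_conjC. Qed.

Lemma sqmod_eq0 z : (sqmod z == 0) = (z == 0).
Proof.
by rewrite -(inj_eq (@complexI R)) sqmodC -normCK expf_eq0 normr_eq0.
Qed.

Lemma ReD z w : complex.Re (z + w) = complex.Re z + complex.Re w.
Proof. by case: z w => [a b] [c d]. Qed.

Lemma ReN z : complex.Re (- z) = - complex.Re z.
Proof. by case: z. Qed.

Lemma ReB z w : complex.Re (z - w) = complex.Re z - complex.Re w.
Proof. by rewrite ReD ReN. Qed.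

Lemma Re_conj z : complex.Re (Num.conj z) = complex.Re z.
Proof. by case: z. Qed.

Lemma ReRM (t : R) z : complex.Re (t%:C * z) = t * complex.Re z.
Proof. by case: z => a b /=; rewrite mul0r subr0. Qed.

Lemma Re_sum (I : Type) (s : seq I) (F : I -> R[i]) :
  complex.Re (\sum_(i <- s) F i) = \sum_(i <- s) complex.Re (F i).
Proof. by apply: (big_morph (@complex.Re R)) => //; exact: ReD. Qed.

Lemma discriminant_le (a b c : R) :
  0 <= a -> (forall t, 0 <= t ^+ 2 * a + 2 * t * b + c) -> b ^+ 2 <= a * c.
Proof.
move=> a0 h; have [az|an0] := eqVneq a 0.
  rewrite {}az mul0r {a a0} in h *.
  have [->|bn0] := eqVneq b 0; first by rewrite expr0n.
  (* At this [t] the affine function [2 * t * b + c] takes the value -1. *)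
  have e : 2 * (- (c + 1) / (2 * b)) * b = - (c + 1) by field.
  by have := h (- (c + 1) / (2 * b)); lra.
have := h (- b / a).
have -> : (- b / a) ^+ 2 * a + 2 * (- b / a) * b + c = (a * c - b ^+ 2) / a.
  by field.
have a1 : 0 < a by rewrite lt_def an0.
by rewrite pmulr_lge0 ?invr_gt0 // subr_ge0.
Qed.

End RealParts.

(** * Real inner product, adjoint pairs and Cauchy-Schwarz *)

Section HilbertNorm.
Context {R : realType} {H : hilbertType R}.
Implicit Types (x y z : H) (t : R) (c : R[i]).

(** Estimates are carried out in the ordered field [R]; [ip] is the inner product of the underlying
    real Hilbert space. *)
Definition nrm x : R := complex.Re `|x|.
Definition ip x y : R := complex.Re (hdot x y).

Lemma nrmE x : `|x| = (nrm x)%:C.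
Proof. by rewrite /nrm RRe_real // ger0_real. Qed.

Lemma nrm_ge0 x : 0 <= nrm x.
Proof. by rewrite -ler0c -nrmE. Qed.

Lemma hdotDl x y z : hdot (x + y) z = hdot x z + hdot y z.
Proof. by rewrite linearDl. Qed.
Lemma hdotBl x y z : hdot (x - y) z = hdot x z - hdot y z.
Proof. by rewrite linearBl. Qed.
Lemma hdotDr x y z : hdot z (x + y) = hdot z x + hdot z y.
Proof. by rewrite linearDr. Qed.
Lemma hdotBr x y z : hdot z (x - y) = hdot z x - hdot z y.
Proof. by rewrite linearBr. Qed.
Lemma hdotZl c x y : hdot (c *: x) y = c * hdot x y.
Proof. by rewrite linearZl_LR. Qed.
Lemma hdotZr c x y : hdot x (c *: y) = Num.conj c * hdot x y.
Proof. by rewrite linearZr_LR. Qed.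
Lemma hdotC x y : hdot x y = Num.conj (hdot y x).
Proof. by rewrite hermC expr0 mul1r. Qed.
Lemma hdot0l y : hdot 0 y = 0.
Proof. by rewrite linear0l. Qed.
Lemma hdot_suml (I : Type) (s : seq I) (F : I -> H) y :
  hdot (\sum_(i <- s) F i) y = \sum_(i <- s) hdot (F i) y.
Proof. by rewrite linear_sumlz. Qed.
Lemma hdot_sumr (I : Type) (s : seq I) (F : I -> H) y :
  hdot y (\sum_(i <- s) F i) = \sum_(i <- s) hdot y (F i).
Proof. by rewrite linear_sumr. Qed.

Lemma hdotxx x : hdot x x = (ip x x)%:C.
Proof. by rewrite /ip RRe_real // -hnorm_hdot realX // ger0_real. Qed.

Lemma nrm2 x : nrm x ^+ 2 = ip x x.
Proof.
by apply: (@complexI R); rewrite -hdotxx -hnorm_hdot nrmE [LHS]rmorphXn.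
Qed.

Lemma nrm2_Re x : complex.Re (`|x| ^+ 2) = nrm x ^+ 2.
Proof. by rewrite nrm2 hnorm_hdot. Qed.

Lemma nrm_eq0 x : (nrm x == 0) = (x == 0).
Proof. by rewrite -(inj_eq (@complexI R)) -nrmE normr_eq0. Qed.

Lemma ipC x y : ip x y = ip y x.
Proof. by rewrite /ip hdotC Re_conj. Qed.
Lemma ipDl x y z : ip (x + y) z = ip x z + ip y z.
Proof. by rewrite /ip hdotDl ReD. Qed.
Lemma ipDr x y z : ip z (x + y) = ip z x + ip z y.
Proof. by rewrite /ip hdotDr ReD. Qed.
Lemma ipBl x y z : ip (x - y) z = ip x z - ip y z.
Proof. by rewrite /ip hdotBl ReB. Qed.
Lemma ipBr x y z : ip z (x - y) = ip z x - ip z y.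
Proof. by rewrite /ip hdotBr ReB. Qed.
Lemma ipZl t x y : ip (t%:C *: x) y = t * ip x y.
Proof. by rewrite /ip hdotZl ReRM. Qed.
Lemma ipZr t x y : ip x (t%:C *: y) = t * ip x y.
Proof. by rewrite ipC ipZl ipC. Qed.

Lemma nrmD x y : nrm (x + y) <= nrm x + nrm y.
Proof.
rewrite -(lecR (nrm (x + y))) [X in _ <= X]rmorphD /= -!nrmE.
exact: ler_normD.
Qed.

Lemma nrmN x : nrm (- x) = nrm x.
Proof. by rewrite /nrm normrN. Qed.

Lemma ip_inj x y : (forall z, ip x z = ip y z) -> x = y.
Proof.
move=> h; apply/eqP; rewrite -subr_eq0 -nrm_eq0 -sqrf_eq0 nrm2.
by rewrite ipBl h subrr.
Qed.

Lemma hdot_inj x y : (forall z, hdot x z = hdot y z) -> x = y.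
Proof. by move=> h; apply: ip_inj => z; rewrite /ip h. Qed.

(** [hermitian_op P] is convertible to [adjoint_pair P P], so facts on adjoint pairs apply to it.
    Linearity of the maps is derived from the identity. *)
Definition hermitian_op (P : H -> H) := forall x y, hdot (P x) y = hdot x (P y).
Definition adjoint_pair (T W : H -> H) :=
  forall x y, hdot (T x) y = hdot x (W y).

Lemma adjoint_pairC T W : adjoint_pair T W -> adjoint_pair W T.
Proof. by move=> h x y; rewrite hdotC -h -hdotC. Qed.

Lemma adjoint_pairD T W : adjoint_pair T W -> {morph T : x y / x + y}.
Proof. by move=> h x y; apply: hdot_inj => z; rewrite hdotDl !h hdotDl. Qed.

Lemma adjoint_pairZ T W : adjoint_pair T W -> forall c, {morph T : x / c *: x}.
Proof. by move=> h c x; apply: hdot_inj => z; rewrite hdotZl !h hdotZl. Qed.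

Lemma adjoint_pairB T W : adjoint_pair T W -> {morph T : x y / x - y}.
Proof. by move=> h x y; apply: hdot_inj => z; rewrite hdotBl !h hdotBl. Qed.

Lemma adjoint_pair_iter T W n :
  adjoint_pair T W -> adjoint_pair (iter n T) (iter n W).
Proof.
by move=> h; elim: n => //= n ih x y; rewrite h ih -iterSr.
Qed.

Lemma hermitian_real P x : hermitian_op P -> hdot (P x) x = (ip (P x) x)%:C.
Proof.
move=> h; rewrite /ip RRe_real //; apply/CrealP; rewrite -hdotC; exact/esym/h.
Qed.

(** Discriminant of the quadratic form of [P] along the line [t%:C *: x + y]. *)
Lemma cauchy_schwarz_op P x y : hermitian_op P -> (forall z, 0 <= ip (P z) z) ->
  ip (P x) y ^+ 2 <= ip (P x) x * ip (P y) y.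
Proof.
move=> hP P0; apply: discriminant_le => // t.
have := P0 (t%:C *: x + y).
rewrite (adjoint_pairD hP) (adjoint_pairZ hP) ipDl !ipDr !ipZl !ipZr.
have -> : ip (P y) x = ip (P x) y by rewrite ipC /ip hP.
by lra.
Qed.

Lemma ip_le x y : `|ip x y| <= nrm x * nrm y.
Proof.
rewrite -(@ler_pXn2r _ 2) ?nnegrE ?mulr_ge0 ?nrm_ge0 // real_normK ?num_real //.
rewrite exprMn !nrm2; apply: (@cauchy_schwarz_op id) => // z.
by rewrite -nrm2 sqr_ge0.
Qed.

End HilbertNorm.

(** * Convergence in norm through real sequences of distances *)

Section Completeness.
Context {R : realType} {H : hilbertType R}.
Implicit Types (x y z l : H) (u v : nat -> H).

Lemma cvg0_le (a b : nat -> R) (K : R) : (forall n, 0 <= a n <= K * b n) ->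
  b @ \oo --> 0 -> a @ \oo --> 0.
Proof.
move=> h hb; apply: (@squeeze_cvgr _ _ _ _ (fun=> 0) (fun n => K * b n)).
- by apply: nearW => n; exact: h.
- exact: cvg_cst.
- by rewrite -(mulr0 K); apply: cvgMr.
Qed.

Lemma cvg0_small (a : nat -> R) e : (forall n, 0 <= a n) -> a @ \oo --> 0 ->
  0 < e -> exists N, forall n, (N <= n)%N -> a n < e.
Proof.
move=> a0 /cvgr0Pnorm_lt h /h [N _ hN]; exists N => n Nn.
by rewrite -(ger0_norm (a0 n)); exact: hN.
Qed.

Definition hcvg u l := (fun n => nrm (u n - l)) @ \oo --> (0 : R).

Lemma hcvgP u l : hcvg u l <-> u @ \oo --> l.
Proof.
split=> [h|/cvgrPdist_lt h].
  apply/cvgrPdist_lt => e e0.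
  (* Radii in [H] are positive elements of [R[i]], hence real. *)
  have ee : e = (complex.Re e)%:C by rewrite RRe_real // gtr0_real.
  have e1 : 0 < complex.Re e by rewrite -ltcR -ee.
  have [N hN] := cvg0_small (fun n => nrm_ge0 (u n - l)) h e1.
  exists N => // n Nn; rewrite distrC nrmE ee ltcR; exact: hN.
apply/cvgr0Pnorm_lt => e e0.
have e1 : 0 < e%:C by rewrite ltcR.
have [N _ hN] := h _ e1; exists N => // n Nn.
by rewrite ger0_norm ?nrm_ge0 // -ltcR -nrmE distrC; exact: hN.
Qed.

Lemma hcvg_cauchy u :
  (forall e, 0 < e -> exists N, forall m n, (N <= m)%N -> (N <= n)%N ->
     nrm (u m - u n) < e) -> exists l, hcvg u l.
Proof.
move=> h; suff : cvg (u @ \oo) by case/cvg_ex => l /hcvgP; exists l.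
apply: cauchy_cvg; apply/cauchyP => e e0.
have ee : e = (complex.Re e)%:C by rewrite RRe_real // gtr0_real.
have e1 : 0 < complex.Re e by rewrite -ltcR -ee.
have [N hN] := h _ e1; exists (u N).
exists N => // n /= Nn; rewrite -ball_normE /= nrmE ee ltcR.
exact: hN.
Qed.

Lemma hcvg_ip u l y : hcvg u l -> ip (u n) y @[n --> \oo] --> ip l y.
Proof.
move=> h; apply/subr_cvg0; apply: norm_cvg0.
have : (fun n => `|ip (u n) y - ip l y|) @ \oo --> (0 : R).
  apply: (cvg0_le (K := nrm y) _ h) => n.
  by rewrite normr_ge0 -ipBl mulrC ip_le.
exact.
Qed.

Lemma ip_lim_eq u l v m x y : hcvg u l -> hcvg v m ->
  (forall n, ip (u n) x = ip (v n) y) -> ip l x = ip m y.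
Proof.
move=> hu hv e; have h1 := hcvg_ip (y := x) hu; have h2 := hcvg_ip (y := y) hv.
have e1 : (fun n => ip (u n) x) = (fun n => ip (v n) y) by apply/funext.
by rewrite e1 in h1; exact: (cvg_unique _ h1 h2).
Qed.

Lemma cvg0_of_sqr (u : nat -> H) (b : nat -> R) (K : R) : 0 < K ->
  (forall n, K * nrm (u n) ^+ 2 <= b n) -> b @ \oo --> 0 -> hcvg u 0.
Proof.
move=> K0 h /cvgr0Pnorm_lt hb; apply/cvgr0Pnorm_lt => e e0.
have e1 : 0 < K * e ^+ 2 by rewrite mulr_gt0 ?exprn_gt0.
have [N _ hN] := hb _ e1; exists N => // n Nn.
rewrite subr0 ger0_norm ?nrm_ge0 //.
rewrite -(@ltr_pXn2r _ 2) ?nnegrE ?nrm_ge0 ?ltW // -(ltr_pM2l K0).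
by apply: le_lt_trans (h n) _; apply: le_lt_trans (ler_norm _) (hN _ Nn).
Qed.

End Completeness.

(** * A variational solution of [ip (S u) y = phi y] for coercive hermitian [S] *)

Section LaxMilgram.
Context {R : realType} {H : hilbertType R}.
Variables (S : H -> H) (A K : R) (phi : H -> R).
Hypotheses (Sherm : hermitian_op S) (A0 : 0 < A)
  (Scoer : forall x, A * nrm x ^+ 2 <= ip (S x) x)
  (phiD : {morph phi : x y / x + y})
  (phiZ : forall t x, phi (t%:C *: x) = t * phi x)
  (phi_le : forall x, phi x <= K * nrm x).
Implicit Types (x y z l : H).

Let J x := ip (S x) x - 2 * phi x.

Let SC x y : ip (S y) x = ip (S x) y.
Proof. by rewrite ipC /ip Sherm. Qed.

Let J_line x y t :
  J (x + t%:C *: y)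
    = J x + (t ^+ 2 * ip (S y) y + 2 * t * (ip (S x) y - phi y)).
Proof.
rewrite /J (adjoint_pairD Sherm) (adjoint_pairZ Sherm) phiD phiZ !(ipDl, ipDr).
rewrite !(ipZl, ipZr) (SC x y); ring.
Qed.

Let J_parallelogram x y :
  J ((2^-1)%:C *: (x + y)) = J x / 2 + J y / 2 - ip (S (x - y)) (x - y) / 4.
Proof.
rewrite /J (adjoint_pairZ Sherm) (adjoint_pairD Sherm) (adjoint_pairB Sherm).
rewrite phiZ phiD !(ipBl, ipBr) !(ipZl, ipZr) !(ipDl, ipDr) (SC x y); by field.
Qed.

Let J_lb x : - (K ^+ 2 / A) <= J x.
Proof.
(* The intermediate quadratic in [nrm x] is bounded below by completing the square. *)
apply: (@le_trans _ _ (A * nrm x ^+ 2 - 2 * (K * nrm x))).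
  rewrite -subr_ge0.
  have -> : A * nrm x ^+ 2 - 2 * (K * nrm x) - - (K ^+ 2 / A)
    = (A * nrm x - K) ^+ 2 / A by field; rewrite gt_eqF.
  by rewrite divr_ge0 ?sqr_ge0 // ltW.
by rewrite /J lerB // ler_pM2l.
Qed.

(* [u] minimises [J]; minimising sequences are Cauchy by [J_parallelogram]. *)
Lemma lax_milgram : exists u, forall y, ip (S u) y = phi y.
Proof.
pose E := range J; pose m := inf E.
have hE : has_inf E.
  split; first by exists (J 0), 0.
  by exists (- (K ^+ 2 / A)) => _ [x _ <-].
have mJ x : m <= J x by apply: ge_inf; [case: hE|exists x].
have /choice[u hu] : forall n : nat, exists x, J x < m + n.+1%:R^-1.
  move=> n; have n0 : 0 < n.+1%:R^-1 :> R by rewrite invr_gt0 ltr0Sn.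
  have [_ [x _ <-] xlt] := inf_adherent n0 hE.
  by exists x.
have ucauchy n k : A * nrm (u n - u k) ^+ 2 < 2 * (n.+1%:R^-1 + k.+1%:R^-1).
  have := mJ ((2^-1)%:C *: (u n + u k)); rewrite J_parallelogram.
  have := Scoer (u n - u k); have := hu n; have := hu k.
  move: (n.+1%:R^-1) (k.+1%:R^-1) => a b; lra.
have [l hl] : exists l, hcvg u l.
  apply: hcvg_cauchy => e e0.
  have d0 : 0 < A * e ^+ 2 / 4 by rewrite divr_gt0 // mulr_gt0 // exprn_gt0.
  have [N _ hN] := near_infty_natSinv_lt (PosNum d0).
  exists N => p q Np Nq; rewrite -(@ltr_pXn2r _ 2) ?nnegrE ?nrm_ge0 ?ltW //.
  rewrite -(ltr_pM2l A0); apply: lt_trans (ucauchy p q) _.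
  have /= := hN _ Np; have /= := hN _ Nq.
  move: (p.+1%:R^-1) (q.+1%:R^-1) => a b; lra.
(* Lower semicontinuity: expand [J (u N)] about [l] by [J_line] at [t = 1], drop the nonnegative
   quadratic term, and bound the linear one by [M * nrm (u N - l)]. *)
have Jl : J l <= m.
  apply/ler_addgt0Pl => e e0.
  pose M := 2 * nrm (S l) + 2 * `|K|.
  have cv : (fun n => n.+1%:R^-1 + M * nrm (u n - l)) @ \oo --> 0.
    rewrite -[X in _ --> X]addr0; apply: cvgD; first exact: cvg_harmonic.
    by rewrite -(mulr0 M); apply: cvgMr.
  have [N hN] : exists N, forall n, (N <= n)%N ->
      n.+1%:R^-1 + M * nrm (u n - l) < e.
    apply: cvg0_small cv e0 => n.
    by rewrite addr_ge0 ?mulr_ge0 ?addr_ge0 ?mulr_ge0 ?nrm_ge0.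
  have := hN N (leqnn N); have := hu N; move: (N.+1%:R^-1) => a.
  have := J_line l (u N - l) 1; rewrite scale1r subrKC => ->.
  have := Scoer (u N - l); have := phi_le (u N - l).
  have := ip_le (S l) (u N - l); rewrite ler_norml => /andP[h1 _].
  have h2 : K * nrm (u N - l) <= `|K| * nrm (u N - l).
    by rewrite ler_wpM2r ?nrm_ge0 ?ler_norm.
  have h3 : 0 <= A * nrm (u N - l) ^+ 2 by rewrite mulr_ge0 ?sqr_ge0 // ltW.
  rewrite /M; lra.
(* By minimality the quadratic increment of [J] at [l] along [y] is nonnegative with zero constant
   term, so its linear coefficient vanishes. *)
exists l => y; apply/eqP; rewrite -subr_eq0 -sqrf_eq0 eq_le sqr_ge0 andbT.
rewrite -(mulr0 (ip (S y) y)); apply: discriminant_le.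
  by apply: le_trans (Scoer y); rewrite mulr_ge0 ?sqr_ge0 // ltW.
by move=> t; have := mJ (l + t%:C *: y); rewrite J_line; lra.
Qed.

End LaxMilgram.

(** * Existence, bounds and invertibility of adjoints *)

Section Adjoint.
Context {R : realType} {H : hilbertType R}.
Implicit Types (T W : H -> H) (x y z : H).

(** Imaginary parts are recovered from real parts by replacing [x] with ['i *: x]. *)
Lemma ip_adjoint_pair T W : (forall c, {morph T : x / c *: x}) ->
  (forall x y, ip (T x) y = ip x (W y)) -> adjoint_pair T W.
Proof.
move=> TZ h x y; apply/eqP; rewrite eq_complex; apply/andP; split.
  by apply/eqP; exact: h.
have := h ('i *: x) y; rewrite /ip TZ !hdotZl.
by rewrite ![_ * hdot _ _]mulrC !ReiNIm => /oppr_inj ->.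
Qed.

Lemma adjointP (T : {linear H -> H}) :
  bounded_operator T -> adjoint_pair T (adjoint T).
Proof.
move=> [M hM].
have TM x : nrm (T x) <= M * nrm x.
  by rewrite -lecR -nrmE (le_trans (hM x)) // nrmE -rmorphM.
have : exists W, adjoint_pair T W.
  suff /choice[W hW] : forall y, exists u, forall x, ip (T x) y = ip x u.
    exists W; apply: ip_adjoint_pair => // c x.
    by rewrite linearZ.
  (* With the identity as operator, [lax_milgram] is the Riesz representation theorem. *)
  move=> y; have := @lax_milgram _ _ id 1 (M * nrm y) (fun x => ip (T x) y).
  case=> //.
  - by move=> x; rewrite mul1r nrm2.
  - by move=> x z; rewrite linearD ipDl.
  - by move=> t x; rewrite linearZ ipZl.
  - move=> x; apply: le_trans (ler_norm _) _; apply: le_trans (ip_le _ _) _.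
    by rewrite mulrAC ler_wpM2r ?nrm_ge0.
  by move=> u hu; exists u => x; rewrite -[LHS]hu ipC.
exact: xgetPex.
Qed.

(** From |T x|^2 = <x, W (T x)>, Cauchy-Schwarz and the bound on [W] at [T x], a factor |T x|^2
    cancels. *)
Lemma adjoint_bound T W k : adjoint_pair T W -> 0 <= k ->
  (forall y, nrm (W y) ^+ 2 <= k * nrm y ^+ 2) ->
  forall x, nrm (T x) ^+ 2 <= k * nrm x ^+ 2.
Proof.
move=> TW k0 hW x.
have [->|T0] := eqVneq (nrm (T x) ^+ 2) 0.
  by rewrite mulr_ge0 ?sqr_ge0.
have T1 : 0 < nrm (T x) ^+ 2 by rewrite lt_def T0 sqr_ge0.
have h : (nrm (T x) ^+ 2) ^+ 2 <= nrm x ^+ 2 * nrm (W (T x)) ^+ 2.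
  rewrite -exprMn [X in X ^+ 2 <= _]nrm2 {1}/ip TW -/(ip _ _).
  rewrite -[X in X <= _]real_normK ?num_real //.
  by rewrite ler_pXn2r ?nnegrE ?mulr_ge0 ?nrm_ge0 // ip_le.
rewrite -(ler_pM2l T1) -expr2; apply: le_trans h _.
rewrite [X in _ <= X](_ : _ = nrm x ^+ 2 * (k * nrm (T x) ^+ 2)); last by ring.
by rewrite ler_wpM2l ?sqr_ge0.
Qed.

(* [T \o W] is hermitian and coercive, so [T (W u) = T y] is solvable. *)
Lemma adjoint_bijective T W c : adjoint_pair T W -> injective T -> 0 < c ->
  (forall y, c * nrm y ^+ 2 <= nrm (W y) ^+ 2) -> bijective W.
Proof.
move=> TW Tinj c0 hW; have WT := adjoint_pairC TW.
have Winj : injective W.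
  move=> x y e; apply/eqP; rewrite -subr_eq0 -nrm_eq0 -sqrf_eq0 eq_le sqr_ge0.
  rewrite andbT -(pmulr_rle0 _ c0) (le_trans (hW _)) //.
  by rewrite (adjoint_pairB WT) e subrr nrm2 /ip hdot0l.
have herm : hermitian_op (T \o W) by move=> x y /=; rewrite TW -WT.
suff /choice[V hV] : forall y, exists x, W x = y.
  by exists V => // x; apply: Winj; rewrite hV.
move=> y; have := @lax_milgram _ _ (T \o W) c (nrm (T y)) (ip (T y)) herm c0.
case.
- by move=> x /=; rewrite /ip TW -/(ip _ _) -nrm2.
- by move=> x z; rewrite ipDr.
- by move=> t x; rewrite ipZr.
- by move=> x; apply: le_trans (ler_norm _) (ip_le _ _).
by move=> u /ip_inj /Tinj <-; exists u.
Qed.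

End Adjoint.

(** * Group law and adjoints for integer powers *)

Section IntegerPowers.
Context {R : realType} {H : hilbertType R}.
Implicit Types (T W : H -> H) (x y z : H).

Let inv T := 'pinv_(fun=> 0) [set: H] T.

Lemma bij_pinvK T : bijective T -> cancel T (inv T) /\ cancel (inv T) T.
Proof.
move=> Tb; have Ti := bij_inj Tb; have K : cancel T (inv T).
  by move=> x; apply: pinvKV; rewrite ?inE //; move=> u v _ _; exact: Ti.
by split=> //; case: Tb => g gK Kg x; rewrite -{1}(Kg x) K Kg.
Qed.

Lemma zpow1D T n x : bijective T -> zpow T (1 + n) x = T (zpow T n x).
Proof.
move=> /bij_pinvK[_ K]; case: n => [k|[|k]]; first by [].
  (* [Negz k] is -(k + 1): here [n] is -1 and the sum is 0. *)
  by rewrite /= K.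
have -> : 1 + Negz k.+1 = Negz k by rewrite !NegzE; lia.
by rewrite [in RHS]/= K.
Qed.

Lemma zpowD T m n x : bijective T -> zpow T (m + n) x = zpow T m (zpow T n x).
Proof.
move=> Tb; elim: m => [|k ih|k ih].
- by rewrite add0r.
- by rewrite intS -addrA !zpow1D // ih.
- apply: (bij_inj Tb); rewrite -!zpow1D // addrA.
  have -> : 1 - k.+1%:Z = - k%:Z by lia.
  exact: ih.
Qed.

Lemma zpowNK T n : bijective T -> cancel (zpow T n) (zpow T (- n)).
Proof. by move=> Tb x; rewrite -zpowD // addNr. Qed.

Lemma adjoint_pair_zpow T W n : adjoint_pair T W -> bijective T ->
  bijective W -> adjoint_pair (zpow T n) (zpow W n).
Proof.
move=> TW /bij_pinvK[_ TK] /bij_pinvK[_ WK].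
case: n => k; apply: adjoint_pair_iter => // x y.
by rewrite -{1}(WK y) -TW TK.
Qed.

End IntegerPowers.

(** * Vectors whose frame coefficients are permuted *)

Section Reindexing.
Context {R : realType} {H : hilbertType R}.

(** A permutation preserves the energy, which is compared with [f] by the lower bound and with [g]
    by the upper one. *)
Lemma frame_reindex_le (I : countType) (F : I -> H) (A B : R) (s : I -> I)
    (f g : H) : frame_with_bounds F A B -> bijective s ->
  (forall i, hdot g (F i) = hdot f (F (s i))) ->
  A * nrm f ^+ 2 <= B * nrm g ^+ 2.
Proof.
move=> [_ _ h] sb e; rewrite -lee_fin -!nrm2_Re.
have /andP[hf _] := h f; have /andP[_ hg] := h g.
apply: le_trans hf _; apply: le_trans _ hg.
rewrite (reindex_esum [set: I] [set: I] s).
- by apply: le_esum => i _; rewrite e.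
- split=> // [i j _ _|j _]; first exact: bij_inj sb i j.
  by case: sb => t _ ts; exists (t j).
Qed.

End Reindexing.

(** * Finite Bessel and synthesis inequalities *)

Section Bessel.
Context {R : realType} {H : hilbertType R}.
Implicit Types (x y z : H).

(** Discriminant of the sum of |t c_i + conj d_i|^2; the conjugate appears because the product
    [c i * d i] carries none. *)
Lemma sum_cauchy_schwarz (I : Type) (s : seq I) (c d : I -> R[i]) :
  complex.Re (\sum_(i <- s) c i * d i) ^+ 2
    <= (\sum_(i <- s) sqmod (c i)) * (\sum_(i <- s) sqmod (d i)).
Proof.
apply: discriminant_le => [|t].
  by apply: sumr_ge0 => i _; exact: sqmod_ge0.
rewrite Re_sum !mulr_sumr -!big_split /=.
apply: sumr_ge0 => i _.
apply: le_trans (sqmod_ge0 (t%:C * c i + Num.conj (d i))) _.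
rewrite le_eqVlt; apply/orP; left; apply/eqP; rewrite !sqmodE.
by case: (c i) (d i) => [a b] [a' b'] /=; ring.
Qed.

Variables (I : countType) (F : I -> H) (A B : R).
Hypothesis frameF : frame_with_bounds F A B.

Lemma frame_finite_le (s : seq I) x : uniq s ->
  \sum_(i <- s) sqmod (hdot x (F i)) <= B * nrm x ^+ 2.
Proof.
move=> us; case: frameF => _ _ /(_ x)/andP[_]; rewrite nrm2_Re => h.
rewrite -lee_fin -sumEFin; apply: le_trans h; apply: esum_ge.
exists [set` s]; first by split=> //; exact: finite_seq.
by rewrite fsbig_seq.
Qed.

(** Synthesis is adjoint to analysis: pair the sum with itself, apply Cauchy-Schwarz to the
    coefficients, then cancel |w|^2. *)
Lemma bessel_synthesis (s : seq I) (c : I -> R[i]) : uniq s ->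
  nrm (\sum_(i <- s) c i *: F i) ^+ 2 <= B * \sum_(i <- s) sqmod (c i).
Proof.
move=> us; set w := \sum_(i <- s) _; set C := \sum_(i <- s) _.
have C0 : 0 <= C by apply: sumr_ge0 => i _; exact: sqmod_ge0.
have B0 : 0 < B by case: frameF.
have h : (nrm w ^+ 2) ^+ 2 <= C * (B * nrm w ^+ 2).
  rewrite {1}nrm2 /ip {1}/w hdot_suml.
  under eq_bigr do rewrite hdotZl.
  apply: le_trans (sum_cauchy_schwarz _ _ _) _; rewrite ler_wpM2l //.
  under eq_bigr do rewrite hdotC sqmod_conj.
  exact: frame_finite_le.
have [->|w0] := eqVneq (nrm w ^+ 2) 0; first by rewrite mulr_ge0 // ltW.
have w1 : 0 < nrm w ^+ 2 by rewrite lt_def w0 sqr_ge0.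
by rewrite -(ler_pM2r w1) -expr2 mulrAC mulrC.
Qed.

End Bessel.

(** * The frame operator as a limit of partial sums *)

Section FrameOperator.
Context {R : realType} {H : hilbertType R}.
Variables (f : nat -> H) (A B : R).
Hypothesis framef : frame_with_bounds f A B.
Implicit Types (x y z : H).

Definition frame_sum n x := \sum_(0 <= i < n) hdot x (f i) *: f i.
Definition energy n x := \sum_(0 <= i < n) sqmod (hdot x (f i)).

Let A0 : 0 < A. Proof. by case: framef. Qed.
Let B0 : 0 < B. Proof. by case: framef. Qed.

(** Passes from the unordered extended-real sum to real partial sums; the upper frame bound makes
    the total finite. *)
Lemma energy_cvg x : exists2 q : R,
  (energy n x) @[n --> \oo] --> q & A * nrm x ^+ 2 <= q <= B * nrm x ^+ 2.
Proof.
case: framef => _ _ /(_ x); rewrite nrm2_Re -nneseries_esumT; last first.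
  by move=> i; rewrite lee_fin sqmod_ge0.
set s := (\sum_(_ <= _ <oo) _)%E => /andP[h1 h2].
have cv : (fun n => (energy n x)%:E) @ \oo --> s.
  have -> : (fun n => (energy n x)%:E)
    = (fun n => \sum_(0 <= i < n) (sqmod (hdot x (f i)))%:E)%E.
    by apply/funext => n; rewrite sumEFin.
  by apply: is_cvg_nneseries => i _ _; rewrite lee_fin sqmod_ge0.
have sfin : s \is a fin_num.
  by rewrite ge0_fin_numE ?(le_lt_trans h2) ?ltry // (le_trans _ h1) //
    lee_fin mulr_ge0 ?sqr_ge0 // ltW.
exists (fine s); last by rewrite -!lee_fin fineK ?h1.
by rewrite -(fineK sfin) in cv; exact: fine_cvg cv.
Qed.

Lemma frame_sum_cvg x : exists l, hcvg (frame_sum ^~ x) l.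
Proof.
have [q cq _] := energy_cvg x; apply: hcvg_cauchy => e e0.
(* Two energies this close to [q] differ by less than [e ^+ 2 / B]; [bessel_synthesis] multiplies
   that by [B]. *)
have d0 : 0 < e ^+ 2 / (2 * B) by rewrite divr_gt0 ?exprn_gt0 // mulr_gt0.
have [N _ hN] := (@cvgrPdist_lt _ R^o _ _ _ _ _).1 cq _ d0.
suff main m n : (N <= m)%N -> (m <= n)%N ->
    nrm (frame_sum n x - frame_sum m x) < e.
  exists N => m n Nm Nn; case: (leqP m n) => [mn|/ltnW nm]; last exact: main.
  by rewrite -nrmN opprB; exact: main.
move=> Nm mn; rewrite -(@ltr_pXn2r _ 2) ?nnegrE ?nrm_ge0 ?ltW //.
have -> : frame_sum n x - frame_sum m x
  = \sum_(i <- index_iota m n) hdot x (f i) *: f i.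
  by rewrite /frame_sum (big_cat_nat (leq0n m) mn) /= addrC addrK.
have := bessel_synthesis framef (fun i => hdot x (f i)) (iota_uniq m (n - m)).
have -> : \sum_(i <- iota m (n - m)) sqmod (hdot x (f i))
  = energy n x - energy m x.
  by rewrite /energy (big_cat_nat (leq0n m) mn) /= addrC addrK.
move=> h; apply: le_lt_trans h _.
rewrite mulrC -ltr_pdivlMr //.
have := hN _ Nm; have := hN _ (leq_trans Nm mn) => /=.
rewrite !ltr_norml => /andP[h1 h2] /andP[h3 h4].
have -> : e ^+ 2 / B = e ^+ 2 / (2 * B) + e ^+ 2 / (2 * B).
  by field; rewrite gt_eqF.
lra.
Qed.

Lemma frame_sum_hermitian n : hermitian_op (frame_sum n).
Proof.
move=> x y; rewrite hdot_suml hdot_sumr; apply: eq_bigr => i _.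
by rewrite hdotZl hdotZr -hdotC mulrC.
Qed.

Lemma frame_operator : exists S : H -> H,
  [/\ hermitian_op S, forall x, hcvg (frame_sum ^~ x) (S x),
      forall x, (energy n x) @[n --> \oo] --> ip (S x) x &
      forall x, A * nrm x ^+ 2 <= ip (S x) x <= B * nrm x ^+ 2].
Proof.
have /choice[S hS] := frame_sum_cvg; exists S.
have sym n := frame_sum_hermitian n.
have en x : (energy n x) @[n --> \oo] --> ip (S x) x.
  have -> : energy ^~ x = (fun n => ip (frame_sum n x) x).
    apply/funext => n; rewrite /ip hdot_suml Re_sum; apply: eq_bigr => i _.
    by rewrite hdotZl [hdot (f i) _]hdotC -sqmodC.
  exact: hcvg_ip (hS x).
split=> //.
- apply: ip_adjoint_pair => [c x|x y].
    (* [S] is a chosen limit, so homogeneity and symmetry are inherited from the partial sums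
       through [ip_lim_eq]. *)
    apply: ip_inj => z; have -> : ip (c *: S x) z = ip (S x) (Num.conj c *: z).
      by rewrite /ip hdotZl hdotZr conjCK.
    apply: ip_lim_eq (hS _) (hS _) _ => n.
    by rewrite /ip hdotZr conjCK !sym hdotZl.
  rewrite [RHS]ipC; apply: ip_lim_eq (hS _) (hS _) _ => n.
  by rewrite ipC /ip sym.
- move=> x; have [q hq] := energy_cvg x.
  by rewrite (cvg_unique _ hq (en x)).
Qed.

End FrameOperator.

(** * The inverse of the frame operator *)

Section FrameInverse.
Context {R : realType} {H : hilbertType R}.
Variables (S : H -> H) (A B : R).
Hypotheses (A0 : 0 < A) (B0 : 0 < B) (Sherm : hermitian_op S)
  (SA : forall x, A * nrm x ^+ 2 <= ip (S x) x)
  (SB : forall x, ip (S x) x <= B * nrm x ^+ 2).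

Lemma frame_inverse : exists D : H -> H,
  [/\ hermitian_op D, cancel D S, cancel S D,
      forall x, nrm x ^+ 2 <= B * ip (D x) x &
      forall x, A * nrm (D x) <= nrm x].
Proof.
have : forall v, exists u, S u = v.
  move=> v; have := @lax_milgram _ _ S A (nrm v) (ip v) Sherm A0 SA.
  case.
  - by move=> x z; rewrite ipDr.
  - by move=> t x; rewrite ipZr.
  - by move=> x; apply: le_trans (ler_norm _) (ip_le _ _).
  by move=> u /ip_inj <-; exists u.
move=> /choice[D SD].
have Sinj : injective S.
  move=> x y e; apply/eqP; rewrite -subr_eq0 -nrm_eq0 -sqrf_eq0 eq_le sqr_ge0.
  rewrite andbT -(pmulr_rle0 _ A0) (le_trans (SA _)) //.
  by rewrite (adjoint_pairB Sherm) e subrr /ip hdot0l.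
have S0 x : 0 <= ip (S x) x.
  by apply: le_trans (SA x); rewrite mulr_ge0 ?sqr_ge0 // ltW.
have DD x : ip (D x) x = ip (S (D x)) (D x) by rewrite SD ipC.
have cancel_le (a b : R) : 0 <= b -> a ^+ 2 <= b * a -> a <= b.
  move=> b0 h; rewrite leNgt; apply/negP => ba.
  by move: h; rewrite expr2 ler_pM2r ?(le_lt_trans b0) // leNgt ba.
exists D; split=> //.
- by move=> x y; rewrite -{1}(SD y) -Sherm SD.
- by move=> x; apply: Sinj; rewrite SD.
- move=> x; apply: cancel_le; first by rewrite mulr_ge0 ?DD // ltW.
  (* For the form of [S] at [D x] and [x] this reads |x|^4 <= <D x, x> <S x, x>; then [SB]
     applies. *)
  have := cauchy_schwarz_op (D x) x Sherm S0; rewrite -DD SD -nrm2 => h.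
  apply: le_trans h _; rewrite mulrAC mulrC.
  by rewrite ler_wpM2r // DD.
move=> x; have [->|D0] := eqVneq (nrm (D x)) 0; first by rewrite mulr0 nrm_ge0.
have D1 : 0 < nrm (D x) by rewrite lt_def D0 nrm_ge0.
rewrite -(ler_pM2r D1) -mulrA -expr2; apply: le_trans (SA _) _.
by rewrite SD; apply: le_trans (ler_norm _) (ip_le _ _).
Qed.

End FrameInverse.

(** * Biorthogonality to the dual system gives a Riesz basis *)

Section RieszBasis.
Context {R : realType} {H : hilbertType R}.
Variables (f : nat -> H) (A B : R) (S D : H -> H).
Hypotheses (framef : frame_with_bounds f A B) (Dherm : hermitian_op D)
  (DS : cancel D S) (Scvg : forall x, hcvg (frame_sum f ^~ x) (S x))
  (D_le : forall x, A * nrm (D x) <= nrm x).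

(** Density comes from [x = S (D x)], a limit of finite sums. A combination [w] has coefficients
    [hdot (D w) (f i)], so the upper frame bound at [D w] controls them. *)
Lemma biorthogonal_riesz_basis :
  (forall i n, hdot (D (f i)) (f n) = (i == n)%:R) -> riesz_basis f.
Proof.
move=> biorth; have [A0 B0 _] := framef; split.
  apply/seteqP; split=> // x _ V nV.
  have /hcvgP cv := Scvg (D x); rewrite DS in cv.
  have [N _ hN] := cv _ nV.
  exists (frame_sum f N (D x)); split; last exact: hN (leqnn N).
  by exists (index_iota 0 N), (fun i => hdot (D x) (f i)).
have sq (s : seq nat) (c : nat -> R[i]) :
    \sum_(i <- s) `|c i| ^+ 2 = (\sum_(i <- s) sqmod (c i))%:C.
  by rewrite rmorph_sum; apply: eq_bigr => i _; rewrite /= sqmodC normCK.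
(* The lower constant combines sum |c_i|^2 <= B |D w|^2 with A |D w| <= |w|. *)
exists (A ^+ 2 / B), B; split=> // [|s c us].
  by rewrite divr_gt0 ?exprn_gt0.
rewrite sq nrmE -rmorphXn -!rmorphM !lecR.
rewrite (bessel_synthesis framef) // andbT.
set w := \sum_(i <- s) c i *: f i.
have ce i : i \in s -> sqmod (c i) = sqmod (hdot (D w) (f i)).
  move=> si; rewrite Dherm hdot_suml (bigD1_seq i) //= big1 ?addr0 => [|k ki].
    by rewrite hdotZl -Dherm biorth eqxx mulr1.
  by rewrite hdotZl -Dherm biorth (negbTE ki) mulr0.
rewrite (eq_big_seq _ ce).
have h := frame_finite_le framef (D w) us.
apply: (@le_trans _ _ ((A * nrm (D w)) ^+ 2)); last first.
  by rewrite ler_pXn2r ?nnegrE ?mulr_ge0 ?nrm_ge0 // ltW.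
rewrite exprMn -mulrA ler_wpM2l ?sqr_ge0 //.
by rewrite mulrC ler_pdivrMr // mulrC.
Qed.

End RieszBasis.

(** * A Schur complement inequality *)

Section SchurComplement.
Context {R : realType} {H : hilbertType R}.
Variables (T W D P : H -> H) (f x : H) (d : R).
Hypotheses (TW : adjoint_pair T W) (Dherm : hermitian_op D)
  (D0 : forall y, 0 <= ip (D y) y) (Pherm : hermitian_op P)
  (TPW : forall y, T (P (W y)) = P y - hdot y f *: f)
  (PDP : forall y, P (D (P y)) = P y)
  (PDx : P (D x) = x) (PDTx : P (D (T x)) = T x) (PDf : P (D f) = f)
  (d0 : 0 < d) (Df : ip (D f) f = 1 - d).

(* [y] is chosen so that [T P W y = T x]; the inequality then expands
   [0 <= ip (D (x - P (W y))) (x - P (W y))]. *)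
Lemma schur_complement_le :
  sqmod (hdot (T x) (D f)) <= d * (ip (D x) x - ip (D (T x)) (T x)).
Proof.
set a := hdot (T x) (D f).
(* [c] solves [c = a + c * (1 - d)], that is [c = hdot y f], which cancels the [f] component of
   [T z]. *)
pose c := d%:C^-1 * a; pose y := D (T x) + c *: D f; pose z := P (W y).
have dC : d%:C != 0 by rewrite (inj_eq (@complexI R)) gt_eqF.
have Tz : T z = T x.
  have -> : T z = P y - hdot y f *: f by rewrite TPW.
  rewrite (adjoint_pairD Pherm) (adjoint_pairZ Pherm) PDTx PDf hdotDl hdotZl.
  rewrite (hermitian_real _ Dherm) Df Dherm -/a -addrA -scalerBl.
  have -> : c - (a + c * (1 - d)%:C) = 0.
    by rewrite /c rmorphB /=; field.
  by rewrite scale0r addr0.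
have Dxz : ip (D x) z = ip (T x) y by rewrite /ip /z -Pherm PDx -TW.
have Dzz : ip (D z) z = ip (T x) y.
  by rewrite /ip {2}/z -Pherm PDP -/z -TW Tz.
have := D0 (x - z); rewrite (adjoint_pairB Dherm) ipBl !ipBr Dzz.
have -> : ip (D z) x = ip (D x) z by rewrite [LHS]ipC /ip Dherm.
rewrite Dxz.
have -> : ip (T x) y = ip (D (T x)) (T x) + sqmod a / d.
  rewrite ipDr [ip (T x) (D _)]ipC; congr (_ + _).
  rewrite /ip hdotZr -/a rmorphM /=.
  have -> : Num.conj d%:C^-1 = (d^-1)%:C.
    by rewrite -fmorphV /= conj_Creal //= complex_real.
  by rewrite -mulrA ReRM mulrC [Num.conj a * _]mulrC -sqmodC.
rewrite -ler_pdivrMl // mulrC; lra.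
Qed.

End SchurComplement.

(** * Forward orbits: adjoint decay, power bounds and tails of the frame operator *)

Section Orbit.
Context {R : realType} {H : hilbertType R}.
Variables (T W S D : H -> H) (f0 : H) (A B : R).
Local Notation f := (fun n => iter n T f0).
Hypotheses (TW : adjoint_pair T W) (framef : frame_with_bounds f A B)
  (Sherm : hermitian_op S) (Dherm : hermitian_op D)
  (DS : cancel D S) (SD : cancel S D)
  (Scvg : forall x, hcvg (frame_sum f ^~ x) (S x))
  (Secvg : forall x, energy f n x @[n --> \oo] --> ip (S x) x)
  (SA : forall x, A * nrm x ^+ 2 <= ip (S x) x)
  (SB : forall x, ip (S x) x <= B * nrm x ^+ 2)
  (DB : forall x, nrm x ^+ 2 <= B * ip (D x) x)
  (D_le : forall x, A * nrm (D x) <= nrm x).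
Implicit Types (x y z : H).

Let A0 : 0 < A. Proof. by case: framef. Qed.
Let B0 : 0 < B. Proof. by case: framef. Qed.

Lemma energyS n x : energy f n.+1 x = energy f n x + sqmod (hdot x (f n)).
Proof. by rewrite /energy big_nat_recr. Qed.

Lemma energy_nondecreasing x :
  {homo (energy f ^~ x) : n m / (n <= m)%N >-> n <= m}.
Proof.
move=> n m nm; rewrite /energy [leRHS](big_cat_nat (leq0n n) nm) /= lerDl.
by apply: sumr_ge0 => i _; exact: sqmod_ge0.
Qed.

Lemma energy_le n x : energy f n x <= ip (S x) x.
Proof.
rewrite -(cvg_lim _ (@Secvg x)) //.
apply: nondecreasing_cvgn_le; first exact: energy_nondecreasing.
by apply/cvg_ex; exists (ip (S x) x); exact: Secvg.
Qed.

Lemma hdot_iter n x i : hdot (iter n W x) (f i) = hdot x (f (i + n)).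
Proof.
by rewrite (adjoint_pair_iter n (adjoint_pairC TW)) -iterD addnC.
Qed.

Lemma adjoint_orbit_energy n x :
  A * nrm (iter n W x) ^+ 2 <= ip (S x) x - energy f n x.
Proof.
apply: le_trans (SA _) _.
have h k : energy f k (iter n W x) <= ip (S x) x - energy f n x.
  rewrite lerBrDl; apply: le_trans (energy_le (n + k) x).
  rewrite /energy [leRHS](big_cat_nat (leq0n n) (leq_addr k n)) /= lerD2l.
  have -> : \sum_(n <= i < n + k) sqmod (hdot x (f i))
      = \sum_(0 <= i < k) sqmod (hdot x (f (i + n))).
    by rewrite -{1}(add0n n) big_addn addKn.
  by under eq_bigr do rewrite hdot_iter.
rewrite -(cvg_lim _ (@Secvg (iter n W x))) //.
apply: limr_le; last by apply: nearW.
by apply/cvg_ex; exists (ip (S (iter n W x)) (iter n W x)); exact: Secvg.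
Qed.

Lemma adjoint_orbit_cvg0 x : hcvg (fun n => iter n W x) 0.
Proof.
apply: (cvg0_of_sqr A0 (adjoint_orbit_energy ^~ x)).
rewrite -(subrr (ip (S x) x)); apply: cvgB; first exact: cvg_cst.
exact: Secvg.
Qed.

(** The powers of [W] obey this bound because their energy is a tail; [adjoint_bound] transfers it
    to [T]. *)
Lemma orbit_power_bounded n x : nrm (iter n T x) ^+ 2 <= B / A * nrm x ^+ 2.
Proof.
apply: (adjoint_bound (adjoint_pair_iter n TW)).
  by rewrite divr_ge0 // ltW.
move=> y; rewrite mulrAC ler_pdivlMr // mulrC.
apply: le_trans (adjoint_orbit_energy n y) _; apply: le_trans (SB y).
by rewrite gerBl; apply: sumr_ge0 => i _; exact: sqmod_ge0.
Qed.

(** Since <W y, f_i> = <y, f_(i+1)> and T f_i = f_(i+1), the sum is shifted by one and the term of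
    index 0 is missing. *)
Lemma T_frame_sum n y :
  T (frame_sum f n (W y)) = frame_sum f n.+1 y - hdot y f0 *: f0.
Proof.
rewrite /frame_sum big_nat_recl //= addrC addKr.
rewrite (big_morph T (id1 := 0) (op1 := +%R)); last first.
- by rewrite -[in LHS](subrr 0) (adjoint_pairB TW) subrr.
- exact: adjoint_pairD TW.
apply: eq_bigr => i _; rewrite (adjoint_pairZ TW); congr (_ *: _).
by rewrite (adjoint_pairC TW).
Qed.

Lemma T_frame_operator y : T (S (W y)) = S y - hdot y f0 *: f0.
Proof.
(* The limit is taken weakly, with [T] moved to the other side as [W]. *)
apply: ip_inj => z; have -> : ip (T (S (W y))) z = ip (S (W y)) (W z).
  by rewrite /ip TW.
have cv : hcvg (fun n => frame_sum f n.+1 y - hdot y f0 *: f0)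
    (S y - hdot y f0 *: f0).
  have := @Scvg y; rewrite /hcvg -cvg_shiftS /=.
  by under [X in _ -> X @ _ --> _]eq_fun do rewrite opprB addrA subrK.
apply: ip_lim_eq (@Scvg (W y)) cv _ => n.
by rewrite -T_frame_sum /ip TW.
Qed.

(* The sum of [hdot y (f n) *: f n] over [n >= j]. *)
Definition tail_op j y := S y - frame_sum f j y.

Lemma tail_op_hermitian j : hermitian_op (tail_op j).
Proof.
by move=> x y; rewrite /tail_op hdotBl hdotBr Sherm frame_sum_hermitian.
Qed.

Lemma T_tail_op j y :
  T (tail_op j (W y)) = tail_op j y - hdot y (f j) *: f j.
Proof.
rewrite /tail_op (adjoint_pairB TW) T_frame_operator T_frame_sum.
rewrite /frame_sum big_nat_recr //= opprB addrA subrK opprD addrA //.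
Qed.

(** * The tail operator after a biorthogonal initial block *)

Section Threshold.
Variable j : nat.
Hypothesis biorth : forall i n, (i < j)%N -> hdot (D (f i)) (f n) = (i == n)%:R.

Lemma frame_sum_low i : (i < j)%N -> frame_sum f j (D (f i)) = f i.
Proof.
move=> ij; rewrite /frame_sum (bigD1_seq i) ?mem_index_iota ?iota_uniq //=.
rewrite big1 => [|k ki]; first by rewrite biorth // eqxx scale1r addr0.
by rewrite biorth // eq_sym (negbTE ki) scale0r.
Qed.

Lemma frame_sum_high n : (j <= n)%N -> frame_sum f j (D (f n)) = 0.
Proof.
move=> jn; rewrite /frame_sum big_nat big1 // => i /andP[_ ij].
rewrite hdotC -Dherm biorth // (_ : _ == _ = false) ?rmorph0 ?scale0r //.
by rewrite ltn_eqF // (leq_trans ij).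
Qed.

Lemma tail_opK n : (j <= n)%N -> tail_op j (D (f n)) = f n.
Proof. by move=> jn; rewrite /tail_op DS frame_sum_high // subr0. Qed.

(** [D (tail_op j y)] differs from [y] by a combination of the [D (f i)] with [i < j], which
    [tail_op j] sends to 0. *)
Lemma tail_op_ginv y : tail_op j (D (tail_op j y)) = tail_op j y.
Proof.
have Ph := tail_op_hermitian j.
rewrite {2}/tail_op (adjoint_pairB Dherm) SD (adjoint_pairB Ph).
rewrite -[RHS]subr0; congr (_ - _); rewrite /frame_sum.
have T0 (Q : H -> H) : hermitian_op Q -> Q 0 = 0.
  by move=> Qh; rewrite -[in LHS](subrr 0) (adjoint_pairB Qh) subrr.
rewrite (big_morph D (adjoint_pairD Dherm) (T0 _ Dherm)).
rewrite (big_morph _ (adjoint_pairD Ph) (T0 _ Ph)).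
rewrite big_nat big1 // => i /andP[_ ij].
rewrite (adjoint_pairZ Dherm) (adjoint_pairZ Ph) {1}/tail_op DS.
by rewrite frame_sum_low // subrr scaler0.
Qed.

End Threshold.

(** The p_n of the overview, equal to the full energy of [D (f n)]. *)
Definition dual_diag n := ip (D (f n)) (f n).

Lemma inverse_ge0 y : 0 <= ip (D y) y.
Proof. by rewrite -(pmulr_rge0 _ B0) (le_trans _ (DB _)) ?sqr_ge0. Qed.

Lemma energy_dual_cvg j : energy f n (D (f j)) @[n --> \oo] --> dual_diag j.
Proof. by have := @Secvg (D (f j)); rewrite DS ipC. Qed.

Lemma energy_dual_le j n : energy f n (D (f j)) <= dual_diag j.
Proof. by have := energy_le n (D (f j)); rewrite DS ipC. Qed.

Lemma sqmod_dual_diag j : sqmod (hdot (D (f j)) (f j)) = dual_diag j ^+ 2.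
Proof. by rewrite hermitian_real // sqmodE /= expr0n addr0. Qed.

(** The left side consists of the terms [j] and [n] of the energy of [D (f j)], whose total is
    [dual_diag j]. *)
Lemma dual_diag_pair j n : n != j ->
  dual_diag j ^+ 2 + sqmod (hdot (D (f j)) (f n)) <= dual_diag j.
Proof.
move=> nj; apply: le_trans (energy_dual_le j (maxn n j).+1).
rewrite /energy (bigD1_seq j) ?mem_index_iota ?iota_uniq ?ltnS ?leq_maxr //=.
rewrite sqmod_dual_diag lerD2l.
have nin : n \in [seq i <- index_iota 0 (maxn n j).+1 | i != j].
  by rewrite mem_filter nj mem_index_iota ltnS leq_maxl.
rewrite -big_filter (bigD1_seq n nin) ?filter_uniq ?iota_uniq //=.
by rewrite lerDl; apply: sumr_ge0 => i _; exact: sqmod_ge0.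
Qed.


Lemma dual_diag_le1 j : dual_diag j <= 1.
Proof.
rewrite leNgt; apply/negP => h.
have n0 : j.+1 != j by rewrite gtn_eqF.
have := dual_diag_pair n0; have := sqmod_ge0 (hdot (D (f j)) (f j.+1)).
by move: h (sqmod _) => h s; nra.
Qed.

Lemma dual_diag1 j : dual_diag j = 1 ->
  forall n, hdot (D (f j)) (f n) = (j == n)%:R.
Proof.
move=> pj n; have [<-|jn] := eqVneq j n.
  by rewrite hermitian_real // -/(dual_diag j) pj.
apply/eqP; rewrite -sqmod_eq0 eq_le sqmod_ge0 andbT.
have nj : n != j by rewrite eq_sym.
by have := dual_diag_pair nj; rewrite pj expr1n gerDl.
Qed.

(** * Decay of the orbit past the first index with p_j < 1 *)

Section Decay.
Variable j : nat.
Hypotheses (low : forall i, (i < j)%N -> dual_diag i = 1)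
  (jlt : dual_diag j < 1).

Let biorth i n (ij : (i < j)%N) := dual_diag1 (low ij) n.
Let d := 1 - dual_diag j.

Lemma dual_diag_step n : (j <= n)%N ->
  sqmod (hdot (D (f j)) (f n.+1)) <= d * (dual_diag n - dual_diag n.+1).
Proof.
move=> jn; rewrite hdotC sqmod_conj.
apply: (@schur_complement_le _ _ T W D (tail_op j) (f j) (f n)) => //.
- exact: inverse_ge0.
- exact: tail_op_hermitian.
- exact: T_tail_op.
- exact: tail_op_ginv.
- exact: tail_opK.
- by rewrite -iterS; apply: (tail_opK biorth); rewrite leqW.
- exact: tail_opK.
- by rewrite subr_gt0.
- by rewrite /d subKr.
Qed.

(** Terms before [j] vanish by biorthogonality, term [j] is the square, and later ones telescope by
    [dual_diag_step]. *)
Lemma dual_diag_bound n : (j <= n)%N ->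
  energy f n.+1 (D (f j)) <= dual_diag j ^+ 2 + d * (dual_diag j - dual_diag n).
Proof.
move=> /subnK <-; elim: (n - j)%N => [|k ih].
  rewrite add0n subrr mulr0 addr0 energyS sqmod_dual_diag gerDr.
  rewrite /energy big_nat big1 // => i /andP[_ ij].
  apply/eqP; rewrite sqmod_eq0 hdotC -Dherm biorth // ltn_eqF //.
  by rewrite rmorph0.
rewrite addSn energyS.
have := dual_diag_step (leq_addl k j); rewrite !mulrBr.
by move: ih; rewrite mulrBr; lra.
Qed.

Lemma orbit_generator_cvg0 : hcvg f 0.
Proof.
have d0 : 0 < d by rewrite subr_gt0.
have dB : 0 < d / B by rewrite divr_gt0.
(* The energy of [D (f j)] after index [n + j]. As [d * dual_diag j = dual_diag j - dual_diag j ^+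
   2], [dual_diag_bound] yields [d * dual_diag (n + j) <= b n]. *)
pose b n := dual_diag j - energy f (n + j.+1) (D (f j)).
have : hcvg (fun n => f (n + j)%N) 0.
  apply: (cvg0_of_sqr (b := b) dB) => [n|]; last first.
    rewrite -(subrr (dual_diag j)); apply: cvgB; first exact: cvg_cst.
    rewrite (cvg_shiftn j.+1 (fun n => energy f n (D (f j)))).
    exact: energy_dual_cvg.
  rewrite mulrAC -mulrA; apply: (@le_trans _ _ (d * dual_diag (n + j))).
    by rewrite (ler_wpM2l (ltW d0)) // ler_pdivrMr // mulrC DB.
  have := dual_diag_bound (leq_addl n j); rewrite /b addnS mulrBr.
  have -> : d * dual_diag j = dual_diag j - dual_diag j ^+ 2.
    by rewrite /d; ring.
  by lra.
by rewrite /hcvg (cvg_shiftn j (fun n => nrm (f n - 0))).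
Qed.

End Decay.

Lemma overcomplete_generator_cvg0 : ~ riesz_basis f -> hcvg f 0.
Proof.
move=> nriesz; have [ex|no] := pselect (exists j, dual_diag j != 1).
  case: (ex_minnP ex) => j pj jmin.
  apply: (@orbit_generator_cvg0 j); last by rewrite lt_neqAle pj dual_diag_le1.
  move=> i ij; apply: contrapT => /eqP /jmin.
  by rewrite leqNgt ij.
exfalso; apply: nriesz.
apply: (biorthogonal_riesz_basis framef Dherm DS Scvg D_le) => i n.
by apply: dual_diag1; apply: contrapT => /eqP pi; apply: no; exists i.
Qed.

(** Finite combinations of the orbit are sent to 0; they approximate [x = S (D x)], and the uniform
    power bound controls the error. *)
Lemma orbit_cvg0 : hcvg f 0 -> forall x, hcvg (fun n => iter n T x) 0.
Proof.
move=> fcvg x; have TnW n := adjoint_pair_iter n TW.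
have sumcvg N : hcvg (fun n => iter n T (frame_sum f N (D x))) 0.
  elim: N => [|N /hcvgP ih]; apply/hcvgP.
    have -> : (fun n => iter n T (frame_sum f 0 (D x))) = (fun=> 0).
      apply/funext => n; rewrite /frame_sum big_nil -[in LHS](subrr 0).
      by rewrite (adjoint_pairB (TnW n)) subrr.
    exact: cvg_cst.
  have -> : (fun n => iter n T (frame_sum f N.+1 (D x))) = (fun n =>
      iter n T (frame_sum f N (D x)) + hdot (D x) (f N) *: f (n + N)%N).
    apply/funext => n; rewrite /frame_sum big_nat_recr //=.
    by rewrite (adjoint_pairD (TnW n)) (adjoint_pairZ (TnW n)) iterD.
  rewrite -[X in _ --> X]addr0; apply: cvgD => //.
  rewrite -[X in _ --> X](scaler0 _ (hdot (D x) (f N))); apply: cvgZr.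
  by rewrite (cvg_shiftn N f); apply/hcvgP.
apply/cvgr0Pnorm_lt => e e0.
(* A uniform bound for the powers of [T]; adding 1 makes its positivity immediate. *)
pose K := Num.sqrt (B / A) + 1.
have K0 : 0 < K by rewrite ltr_wpDl ?sqrtr_ge0.
have TK n y : nrm (iter n T y) <= K * nrm y.
  rewrite -(@ler_pXn2r _ 2) ?nnegrE ?mulr_ge0 ?nrm_ge0 ?(ltW K0) // exprMn.
  apply: le_trans (orbit_power_bounded n y) _; rewrite ler_wpM2r ?sqr_ge0 //.
  have BA0 : 0 <= B / A by rewrite divr_ge0 // ltW.
  rewrite -[leLHS](sqr_sqrtr BA0).
  by rewrite ler_pXn2r ?nnegrE ?sqrtr_ge0 ?(ltW K0) // lerDl.
have [N hN] := cvg0_small (fun n => nrm_ge0 _) (@Scvg (D x))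
  (divr_gt0 e0 (mulr_gt0 (ltr0n _ 2) K0)).
have [M hM] := cvg0_small (fun n => nrm_ge0 _) (sumcvg N)
  (divr_gt0 e0 (ltr0n _ 2)).
exists M => // n Mn; rewrite subr0 ger0_norm ?nrm_ge0 //.
have := hN N (leqnn N); have := hM n Mn; rewrite DS subr0 => h1 h2.
have -> : iter n T x = iter n T (frame_sum f N (D x))
    - iter n T (frame_sum f N (D x) - x).
  by rewrite (adjoint_pairB (TnW n)) subKr.
apply: le_lt_trans (nrmD _ _) _; rewrite nrmN.
have := TK n (frame_sum f N (D x) - x).
move: h2; rewrite ltr_pdivlMr ?mulr_gt0 //; lra.
Qed.

End Orbit.

(** * Decay of forward orbits and lower bounds for two-sided orbits *)

Unset Implicit Arguments.

Theorem theorem1p2 (R : realType) (H : hilbertType R)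
    (Hsep : separable H) (Hinf : infinite_dimensional H) :
  (forall (T : {linear H -> H}) (f0 : H),
      bounded_operator T ->
      overcomplete_frame (fun n : nat => iter n T f0) ->
      forall f : H,
        ((fun n : nat => iter n T f) @ \oo --> (0 : H)) /\
        ((fun n : nat => iter n (adjoint T) f) @ \oo --> (0 : H)))
  /\
  (forall (T : {linear H -> H}) (f0 : H) (A B : R),
      bounded_operator T -> bijective T ->
      frame_with_bounds (fun n : int => zpow T n f0) A B ->
      forall (f : H) (n : int),
        (Num.sqrt (A / B))%:C * `|f| <= `|zpow T n f| /\
        (Num.sqrt (A / B))%:C * `|f| <= `|zpow (adjoint T) n f|).
Proof.
split=> [T f0 /adjointP TW [[A [B frF]] over] f
        |T f0 A B /adjointP TW Tb frF f n].
  have [S [Sherm Scvg Secvg SAB]] := frame_operator frF.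
  have [A0 B0 _] := frF.
  have SA x : A * nrm x ^+ 2 <= ip (S x) x by case/andP: (SAB x).
  have SB x : ip (S x) x <= B * nrm x ^+ 2 by case/andP: (SAB x).
  have [D [Dherm DS SD DB D_le]] := frame_inverse A0 B0 Sherm SA SB.
  split; apply/hcvgP; last exact: adjoint_orbit_cvg0 TW frF Secvg SA f.
  apply: (orbit_cvg0 TW frF DS Scvg Secvg SA SB).
  exact: (overcomplete_generator_cvg0
    TW frF Sherm Dherm DS SD Scvg Secvg DB D_le).
have [A0 B0 _] := frF.
have AB0 : 0 < A / B by rewrite divr_gt0.
have lower (g h : H) : A * nrm g ^+ 2 <= B * nrm h ^+ 2 ->
    (Num.sqrt (A / B))%:C * `|g| <= `|h|.
  move=> gh; rewrite !nrmE -rmorphM lecR.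
  rewrite -(@ler_pXn2r _ 2) ?nnegrE ?mulr_ge0 ?nrm_ge0 ?sqrtr_ge0 //.
  by rewrite exprMn sqr_sqrtr ?(ltW AB0) // mulrAC ler_pdivrMr // [leRHS]mulrC.
(* Needed for the pseudo-inverse in [zpow (adjoint T)] to be the inverse. Coercivity follows by
   shifting the indices by one. *)
have Wb : bijective (adjoint T).
  apply: (adjoint_bijective TW (bij_inj Tb) AB0) => y.
  rewrite mulrAC ler_pdivrMr // [leRHS]mulrC.
  apply: (frame_reindex_le frF (s := fun m => 1 + m)) => [|m].
    by exists (fun m => m - 1) => m; rewrite [1 + _]addrC ?addrK ?subrK.
  by rewrite zpow1D // (adjoint_pairC TW).
have TWn m := adjoint_pair_zpow m TW Tb Wb.
have Wlower m g : A * nrm g ^+ 2 <= B * nrm (zpow (adjoint T) m g) ^+ 2.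
  apply: (frame_reindex_le frF (s := fun k => m + k)) => [|k].
    by exists (fun k => k - m) => k; rewrite [m + _]addrC ?addrK ?subrK.
  by rewrite zpowD // (adjoint_pairC (TWn m)).
split; apply: lower => //.
(* The lower bound on the power [n] of the adjoint bounds its inverse above; the same bound for
   T^(-n), applied to T^n f, is the claim for [T]. *)
have Wupper g : nrm (zpow (adjoint T) (- n) g) ^+ 2 <= B / A * nrm g ^+ 2.
  rewrite mulrAC ler_pdivlMr // mulrC.
  by have := Wlower n (zpow (adjoint T) (- n) g); rewrite -zpowD // subrr.
have BA0 : 0 <= B / A by rewrite divr_ge0 // ltW.
have := adjoint_bound (TWn (- n)) BA0 Wupper (zpow T n f).
by rewrite zpowNK // mulrAC ler_pdivlMr // mulrC.
Qed.
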